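(* Fix $\gamma>0$ and, for $0<\epsilon<1$, let $T=T(\epsilon)$ be given by $\gamma=\epsilon\sqrt T$ and let $\kappa=1-\epsilon^2$. Let $\bar u$ be the function defined in the context, where either $\sigma=\kappa$ for all $\epsilon$ or $\sigma=2\epsilon\big/\log\big(\frac{1+\epsilon}{1-\epsilon}\big)$ for all $\epsilon$, and where the constant $b=b(\epsilon)>0$ has leading order term $\frac1\epsilon$ as $\epsilon\to0$ (i.e. $\epsilon b(\epsilon)\to1$). Then $$\lim_{\epsilon\to0}\frac1{\sqrt T}\,\bar u(\epsilon T,0,-T)=\bar c(\gamma),\qquad \bar c(\gamma)=\Big(\frac1\gamma-\gamma\Big)\mathrm{erf}\Big(\frac\gamma{\sqrt2}\Big)-\sqrt{\frac2\pi}\,e^{-\gamma^2/2}+\gamma .$$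
   Context: $\mathrm{erf}(y)=\frac2{\sqrt\pi}\int_0^ye^{-s^2}ds$. For $\xi^r,s_2\in\mathbb R$, $t<0$ and parameters $\sigma,b>0$, $$\bar u(\xi^r,s_2,t)=2\epsilon s_2+\bar\varphi(\xi^r+\epsilon t)-\int_{\mathbb R}\Phi(\xi^r-s,t)\bar\varphi(s)\,ds,\qquad \Phi(s,t)=\frac1{\sqrt{-2\pi\kappa t}}\exp\Big(\frac{s^2}{2\kappa t}\Big),\quad \kappa=1-\epsilon^2,$$ with $\bar\varphi(y)=-2y$ for $y\le0$ and $\bar\varphi(y)=b e^{-2\epsilon y/\sigma}-b$ for $y>0$. *)

(* Defs.v *)
From mathcomp Require Import all_boot all_order all_algebra.
From mathcomp Require Import all_classical all_reals all_analysis.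

Set Implicit Arguments.
Unset Strict Implicit.
Unset Printing Implicit Defensive.
Import Order.TTheory GRing.Theory Num.Theory.
Import numFieldNormedType.Exports.
Local Open Scope classical_set_scope.
Local Open Scope ring_scope.

(* The integral from 0 to y is oriented, hence the case split on the sign of y. *)
Definition erf {R : realType} (y : R) : R :=
  2 / Num.sqrt pi *
  (if 0 <= y
   then \int[lebesgue_measure]_(s in `[0, y]) expR (- s ^+ 2)
   else - \int[lebesgue_measure]_(s in `[y, 0]) expR (- s ^+ 2)).

Definition kappa {R : realType} (eps : R) : R := 1 - eps ^+ 2.

Definition Phi {R : realType} (eps s t : R) : R :=
  (Num.sqrt (- 2 * pi * kappa eps * t))^-1 *
  expR (s ^+ 2 / (2 * kappa eps * t)).

Definition phibar {R : realType} (eps sigma b y : R) : R :=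
  if y <= 0 then - 2 * y else b * expR (- 2 * eps * y / sigma) - b.

(* Only meaningful for [0 < eps < 1], [0 < sigma], [0 < b] and [t < 0]; the
   integrand is then Lebesgue-integrable over the whole line. *)
Definition ubar {R : realType} (eps sigma b xi s2 t : R) : R :=
  2 * eps * s2 + phibar eps sigma b (xi + eps * t)
  - \int[lebesgue_measure]_(s in [set: R])
      (Phi eps (xi - s) t * phibar eps sigma b s).

Definition cbar {R : realType} (gamma : R) : R :=
  (gamma^-1 - gamma) * erf (gamma / Num.sqrt 2)
  - Num.sqrt (2 / pi) * expR (- gamma ^+ 2 / 2) + gamma.

(* Main.v *)
Require Import Defs.
From mathcomp Require Import all_boot all_order all_algebra.
From mathcomp Require Import all_classical all_reals all_analysis.
From mathcomp Require Import measurable_realfun ring.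

Set Implicit Arguments.
Unset Strict Implicit.
Unset Printing Implicit Defensive.
Import Order.TTheory GRing.Theory Num.Theory.
Import numFieldNormedType.Exports.
Local Open Scope classical_set_scope.
Local Open Scope ring_scope.

(** Since [xi + eps * t = 0], only the Gaussian integral of [phibar] survives.
    It is evaluated in closed form: the linear branch of [phibar] gives a first
    moment on a half-line, and the exponential branch, after completing the
    square, a difference of two half-line masses, all expressed through [erf].
    With [eps = gamma / sqrt T] the scale [sqrt T] drops out, and
    [ubar / sqrt T] becomes a continuous function of [kappa], [sigma] and
    [eps * b], which all tend to 1. *)

(** * The error function: derivative, oddness and limit at infinity *)

Section error_function.
Context {R : realType}.
Local Notation mu := (@lebesgue_measure R).
Implicit Types y : R.

Lemma integrable_gauss_fun (A : set R) : measurable A ->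
  mu.-integrable A (EFin \o @gauss_fun R).
Proof. by move=> mA; apply: integrableS (integrableT_gauss). Qed.

Lemma Rintegral_gauss_funNy0 :
  \int[mu]_(x in `]-oo, 0]) gauss_fun x = Num.sqrt pi / 2.
Proof.
rewrite /Rintegral -{1}oppr0 ge0_integration_by_substitutionNy.
- rewrite -[RHS]/(fine (Num.sqrt pi / 2)%:E) -integral0y_gauss.
  by congr fine; apply: eq_integral => x _; rewrite /= /gauss_fun sqrrN.
- exact/continuous_subspaceT/continuous_gauss_fun.
- by move=> x _; exact: gauss_fun_ge0.
Qed.

(* This form avoids the case split in [erf] when differentiating. *)
Lemma erfE y :
  erf y = 2 / Num.sqrt pi * (\int[mu]_(x in `]-oo, y]) gauss_fun x) - 1.
Proof.
have pi0 : Num.sqrt (pi : R) != 0 by rewrite gt_eqF// sqrtr_gt0 pi_gt0.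
have -> : \int[mu]_(x in `]-oo, y]) gauss_fun x =
    (if 0 <= y then \int[mu]_(s in `[0, y]) expR (- s ^+ 2)
     else - \int[mu]_(s in `[y, 0]) expR (- s ^+ 2)) + Num.sqrt pi / 2.
  rewrite -Rintegral_gauss_funNy0; case: ifPn => [y0|]; last rewrite -ltNge => y0.
  - rewrite -Rintegral_itv_obnd_cbnd; last exact: integrable_gauss_fun.
    rewrite -(@Rintegral_itvB _ _ -oo%O) ?bnd_simp//; last exact: integrable_gauss_fun.
    by rewrite subrK.
  - rewrite -Rintegral_itv_obnd_cbnd; last exact: integrable_gauss_fun.
    rewrite -(@Rintegral_itvB _ _ -oo%O) ?bnd_simp ?(ltW y0)//;
      last exact: integrable_gauss_fun.
    by rewrite opprB subrK.
have h : 2 / Num.sqrt pi * (Num.sqrt pi / 2) = 1 :> R by field.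
by rewrite mulrDr h addrK.
Qed.

Lemma is_derive_erf y : is_derive y 1 erf (2 / Num.sqrt pi * gauss_fun y).
Proof.
(* The fundamental theorem needs a domain reaching beyond [y]; [y + 1] is an arbitrary upper end. *)
have y1 : y < y + 1 by rewrite ltrDl.
have [d d'] := continuous_FTC1 y1 (integrable_gauss_fun (measurable_itv `]-oo, y + 1]))
  (ltNyr y) (@continuous_gauss_fun R y).
rewrite (_ : erf = (fun y : R =>
  2 / Num.sqrt pi * (\int[mu]_(x in `]-oo, y]) gauss_fun x) - 1)); last first.
  by apply/funext => z; rewrite erfE.
have dF := DeriveDef d (erefl _); rewrite -derive1E d' in dF.
by apply: is_derive_eq; rewrite subr0.
Qed.

Lemma continuous_erf : continuous (@erf R).
Proof.
move=> y; have [+ _] := is_derive_erf y.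
by move=> /derivable1_diffP/differentiable_continuous.
Qed.

Lemma erf0 : erf (0 : R) = 0.
Proof. by rewrite /erf lexx set_itv1 Rintegral_set1 mulr0. Qed.

(** Since [gauss_fun] is even, [erf (- x) + erf x] has zero derivative, so it keeps its value 0 at
    the origin. *)
Lemma erfN y : erf (- y) = - erf y.
Proof.
apply/eqP; rewrite -addr_eq0; apply/eqP.
have -> : 0 = erf (- 0 : R) + erf (0 : R) by rewrite oppr0 erf0 addr0.
apply: (@is_derive_0_is_cst R (fun x => erf (- x) + erf x)) => x.
have d1 := is_derive_erf x; have d2 := is_derive_erf (- x).
have d3 : is_derive x 1 (fun x : R => erf (- x))
   (2 / Num.sqrt pi * gauss_fun (- x) * -1).
  apply: (@is_derive1_comp R erf -%R) => //.
by apply: is_derive_eq; rewrite /gauss_fun sqrrN mulrN1 addNr.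
Qed.

(** The square of the Gaussian integral from 0 to [x] tends to [pi / 4]. That integral is
    nonnegative, so square roots give the limit [Num.sqrt pi / 2], which the normalization of [erf]
    turns into 1. *)
Lemma cvg_erf_pinfty : erf x @[x --> +oo] --> (1 : R).
Proof.
have pi0 : 0 < Num.sqrt (pi : R) by rewrite sqrtr_gt0 pi_gt0.
pose I := @gauss_integral_proof.integral0_gauss R.
have cI : I x @[x --> +oo] --> Num.sqrt pi / 2.
  have -> : Num.sqrt pi / 2 = Num.sqrt (pi / 4) :> R.
    rewrite sqrtrM ?pi_ge0// sqrtrV// (_ : 4 = 2 ^+ 2 :> R); last by ring.
    by rewrite sqrtr_sqr ger0_norm.
  have -> : I = fun x => Num.sqrt (I x ^+ 2).
    apply/funext => x; rewrite sqrtr_sqr ger0_norm//.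
    exact: gauss_integral_proof.integral0_gauss_ge0.
  apply: continuous_cvg; first exact: sqrt_continuous.
  exact: gauss_integral_proof.cvg_integral0_gauss_sqr.
have -> : 1 = 2 / Num.sqrt pi * (Num.sqrt pi / 2) :> R by field; rewrite gt_eqF.
have h : 2 / Num.sqrt pi * I x @[x --> +oo] --> 2 / Num.sqrt pi * (Num.sqrt pi / 2).
  by apply: cvgM => //; exact: cvg_cst.
apply: cvg_trans h; apply: near_eq_cvg.
by near=> x; rewrite /erf ifT.
Unshelve. all: by end_near. Qed.

End error_function.

(** * Gaussian densities: masses and first moments on a half-line, exponential tilting *)

Section gauss_density.
Context {R : realType}.
Local Notation mu := (@lebesgue_measure R).
Implicit Types v m x : R.

(** The antiderivative shows that the extended-real integral is finite, and for a nonnegative [f]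
    this finiteness is integrability; hence both facts come out together. *)
Lemma ge0_FTC_half_line (f F : R -> R) (a l : R) :
  (forall x, a <= x -> 0 <= f x) -> continuous f ->
  F x @[x --> +oo] --> l -> (forall x, is_derive x 1 F (f x)) ->
  mu.-integrable `[a, +oo[ (EFin \o f) /\
  \int[mu]_(x in `[a, +oo[) f x = l - F a.
Proof.
move=> f0 cf Fl dF.
have cF : F x @[x --> a^'+] --> F a.
  apply: cvg_at_right_filter; have [+ _] := dF a.
  by move=> /derivable1_diffP/differentiable_continuous.
have E : (\int[mu]_(x in `[a, +oo[) (f x)%:E = l%:E - (F a)%:E)%E.
  apply: ge0_continuous_FTC2y => //; first exact: continuous_subspaceT.
  by move=> x _; rewrite derive1E derive_val.
have mf : measurable_fun `[a, +oo[ f.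
  by apply: measurable_funTS; exact: continuous_measurable_fun.
split; last by rewrite /Rintegral E.
apply/integrableP; split; first exact/measurable_EFinP.
by rewrite integral_fin_num_abs// E.
Qed.

(** The centred normal density of variance [v], written through [gauss_fun] so that its calculus
    reduces to that of [gauss_fun] and [erf]. *)
Definition gauss_density v x :=
  (Num.sqrt (2 * pi * v))^-1 * gauss_fun (x / Num.sqrt (2 * v)).

Lemma gauss_density_ge0 v x : 0 <= gauss_density v x.
Proof. by rewrite mulr_ge0 ?invr_ge0 ?sqrtr_ge0 ?gauss_fun_ge0. Qed.

Lemma gauss_densityN v x : gauss_density v (- x) = gauss_density v x.
Proof. by rewrite /gauss_density /gauss_fun mulNr sqrrN. Qed.

Lemma is_derive_gauss_fun x : is_derive x 1 gauss_fun (- 2 * x * gauss_fun x).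
Proof.
apply: (@is_derive_eq R _ _ _ _ _ _ (gauss_fun x * (- (2 * x)))); last by ring.
apply: (@is_derive1_comp R expR (fun y => - y ^+ 2)).
by apply: is_derive_eq; rewrite /GRing.scale/=; ring.
Qed.

Lemma is_derive_comp_standardize (f : R -> R) c m x df :
  is_derive ((x - m) / c) 1 f df ->
  is_derive x 1 (fun y => f ((y - m) / c)) (df / c).
Proof.
move=> d; apply: (@is_derive1_comp R f (fun y => (y - m) / c)).
by apply: is_derive_eq; rewrite /GRing.scale/=; ring.
Qed.

Section fixed_variance.
Variables (v : R) (v0 : 0 < v).
Local Notation c := (Num.sqrt (2 * v)).

Let c0 : 0 < c. Proof. by rewrite sqrtr_gt0 mulr_gt0. Qed.

Let sqrtE : Num.sqrt (2 * pi * v) = Num.sqrt pi * c.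
Proof. by rewrite -sqrtrM ?pi_ge0// mulrCA mulrA. Qed.

Lemma is_derive_erf_gauss_density m x :
  is_derive x 1 (fun y => erf ((y - m) / c) / 2) (gauss_density v (x - m)).
Proof.
have d := is_derive_comp_standardize (is_derive_erf ((x - m) / c)).
have pi0 : 0 < Num.sqrt (pi : R) by rewrite sqrtr_gt0 pi_gt0.
apply: is_derive_eq.
rewrite /GRing.scale/= /gauss_density sqrtE.
by field; rewrite !gt_eqF.
Qed.

(** Supplies the antiderivative of the centred part [x - m] of the first moment. *)
Lemma is_derive_gauss_density m x :
  is_derive x 1 (fun y => v * gauss_density v (y - m))
    (- (x - m) * gauss_density v (x - m)).
Proof.
have d := is_derive_comp_standardize (is_derive_gauss_fun ((x - m) / c)).
have pi0 : 0 < Num.sqrt (pi : R) by rewrite sqrtr_gt0 pi_gt0.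
rewrite /gauss_density; apply: is_derive_eq.
rewrite /GRing.scale/= /gauss_density sqrtE.
(* Eliminating [v] in favour of its square root [c] leaves a rational identity for [field]. *)
have : v = c ^+ 2 / 2 by rewrite sqr_sqrtr ?mulr_ge0 ?ltW//; field.
by move: c c0 => k k0 ->; field; rewrite !gt_eqF.
Qed.

Lemma continuous_gauss_density m : continuous (fun x => gauss_density v (x - m)).
Proof.
move=> x; apply: cvgM; first exact: cvg_cst.
have [+ _] := is_derive_comp_standardize (is_derive_gauss_fun ((x - m) / c)).
by move=> /derivable1_diffP/differentiable_continuous.
Qed.

Lemma cvg_standardize m : (x - m) / c @[x --> +oo] --> +oo.
Proof.
apply: gt0_cvgMly; first by rewrite invr_gt0.
exact: cvg_addrr.
Qed.

Lemma cvg_gauss_density m : gauss_density v (x - m) @[x --> +oo] --> (0 : R).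
Proof.
rewrite -[X in _ --> X](mulr0 (Num.sqrt (2 * pi * v))^-1).
apply: cvgM; first exact: cvg_cst.
apply: (cvg_comp (fun x => (x - m) / c) gauss_fun); first exact: cvg_standardize.
exact: cvg_gauss_fun.
Qed.

Lemma cvg_erf_standardize m : erf ((x - m) / c) / 2 @[x --> +oo] --> (2^-1 : R).
Proof.
rewrite -[X in _ --> X]mul1r; apply: cvgM; last exact: cvg_cst.
apply: (cvg_comp (fun x => (x - m) / c) erf); first exact: cvg_standardize.
exact: cvg_erf_pinfty.
Qed.

Lemma gauss_density_half_line m :
  mu.-integrable `[0, +oo[ (EFin \o (fun x => gauss_density v (x - m))) /\
  \int[mu]_(x in `[0, +oo[) gauss_density v (x - m) = (1 + erf (m / c)) / 2.
Proof.
have [||||I E] := @ge0_FTC_half_line (fun x => gauss_density v (x - m))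
    (fun x => erf ((x - m) / c) / 2) 0 2^-1.
- by move=> x _; exact: gauss_density_ge0.
- exact: continuous_gauss_density.
- exact: cvg_erf_standardize.
- exact: is_derive_erf_gauss_density.
by split=> //; rewrite E sub0r mulNr erfN; field.
Qed.

(** Write [x = m + (x - m)]: the first part integrates to a multiple of [erf], the second to [- v]
    times the density, which vanishes at infinity. *)
Lemma gauss_density_moment_half_line m :
  mu.-integrable `[0, +oo[ (EFin \o (fun x => x * gauss_density v (x - m))) /\
  \int[mu]_(x in `[0, +oo[) (x * gauss_density v (x - m)) =
    v * gauss_density v m + m * ((1 + erf (m / c)) / 2).
Proof.
have [||||I E] := @ge0_FTC_half_line (fun x => x * gauss_density v (x - m))
    (fun x => m * (erf ((x - m) / c) / 2) - v * gauss_density v (x - m)) 0 (m * 2^-1 - v * 0).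
- by move=> x x0; rewrite mulr_ge0// gauss_density_ge0.
- move=> x; apply: cvgM; first exact: cvg_id.
  exact: continuous_gauss_density.
- apply: cvgB; (apply: cvgM; first exact: cvg_cst).
    exact: cvg_erf_standardize.
  exact: cvg_gauss_density.
- move=> x; have d1 := is_derive_erf_gauss_density m x.
  have d2 := is_derive_gauss_density m x.
  by apply: is_derive_eq; rewrite /GRing.scale/=; ring.
by split=> //; rewrite E sub0r mulNr erfN gauss_densityN; field.
Qed.

(** Completing the square: an exponential weight moves the mean by [- lam * v] and leaves a constant
    factor. *)
Lemma gauss_density_tilt lam m x :
  gauss_density v (x - m) * expR (- lam * x) =
  expR (lam ^+ 2 * v / 2 - lam * m) * gauss_density v (x - (m - lam * v)).
Proof.
rewrite /gauss_density mulrCA -mulrA; congr (_ * _).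
rewrite /gauss_fun -!expRD; congr expR.
have c2 : c ^+ 2 = 2 * v by rewrite sqr_sqrtr ?mulr_ge0 ?ltW.
by rewrite !expr_div_n c2; field; rewrite gt_eqF.
Qed.

End fixed_variance.
End gauss_density.

(** * The Gaussian integral of [phibar] in closed form *)

Section initial_datum.
Context {R : realType}.
Local Notation mu := (@lebesgue_measure R).

(** The point 0 belongs to the left branch, while the half-line formulas include it on the right as
    well; a single point is a null set. *)
Lemma Rintegral_split0 (f g h : R -> R) :
  mu.-integrable `]-oo, 0] (EFin \o f) ->
  mu.-integrable `[0, +oo[ (EFin \o g) ->
  (forall x, h x = if x <= 0 then f x else g x) ->
  \int[mu]_x h x =
  \int[mu]_(x in `]-oo, 0]) f x + \int[mu]_(x in `[0, +oo[) g x.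
Proof.
move=> intf intg hE.
have hf : {in `]-oo, 0]%classic, f =1 h}.
  by move=> x; rewrite inE/= in_itv/= hE => ->.
have hg : {in `]0, +oo[%classic, g =1 h}.
  by move=> x; rewrite inE/= in_itv/= andbT hE ltNge => /negbTE ->.
have U : [set: R] = `]-oo, 0] `|` `]0, +oo[.
  by rewrite -setCitvl setUv.
have intg' : mu.-integrable `]0, +oo[ (EFin \o g).
  by apply: integrableS intg => //; apply: subset_itvr; rewrite bnd_simp.
rewrite -(Rintegral_itv_obnd_cbnd intg').
have -> : \int[mu]_(x in `]-oo, 0]) f x = \int[mu]_(x in `]-oo, 0]) h x.
  exact: eq_Rintegral.
have -> : \int[mu]_(x in `]0, +oo[) g x = \int[mu]_(x in `]0, +oo[) h x.
  exact: eq_Rintegral.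
rewrite U Rintegral_setU//; last first.
  apply/disj_set2P; rewrite -subset0 => x [] /=; rewrite !in_itv/= andbT.
  by move=> x0 /(le_lt_trans x0); rewrite ltxx.
rewrite -U.
(* Additivity over the union asks for integrability of [h], which is the sum of the extensions by
   zero of [f] and [g]. *)
have intfT : mu.-integrable setT ((EFin \o f) \_ `]-oo, 0]).
  by apply/(integrable_mkcond _ _).1.
have intgT : mu.-integrable setT ((EFin \o g) \_ `]0, +oo[).
  by apply/(integrable_mkcond _ _).1.
have := integrableD measurableT intfT intgT.
apply: eq_integrable => // x _.
rewrite /= !patchE hE !mem_setE !in_itv/= andbT ltNge.
by case: ifPn; rewrite ?adde0 ?add0e.
Qed.

(** Nonnegativity allows the substitution before integrability on the left is known; finiteness of
    the reflected integral then yields it. *)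
Lemma Rintegral_half_line_opp (f : R -> R) :
  continuous f -> (forall x, x <= 0 -> 0 <= f x) ->
  mu.-integrable `[0, +oo[ (EFin \o (fun x => f (- x))) ->
  mu.-integrable `]-oo, 0] (EFin \o f) /\
  \int[mu]_(x in `]-oo, 0]) f x = \int[mu]_(x in `[0, +oo[) f (- x).
Proof.
move=> cf f0 intf.
have E : (\int[mu]_(x in `]-oo, 0%R]) (f x)%:E =
    \int[mu]_(x in `[0%R, +oo[) (f (- x))%:E)%E.
  rewrite -{1}oppr0 ge0_integration_by_substitutionNy//.
    exact: continuous_subspaceT.
  by move=> x; rewrite oppr0 in_itv/= => /ltW; exact: f0.
have mf : measurable_fun `]-oo, (0 : R)] f.
  by apply: measurable_funTS; exact: continuous_measurable_fun.
split; last by rewrite /Rintegral E.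
apply/integrableP; split; first exact/measurable_EFinP.
rewrite integral_fin_num_abs// E.
exact: (integrable_fin_num _ intf).
Qed.

(** Reflecting the linear branch gives a first moment for the mean [- m]. The exponential branch
    gives a tilted mass for the mean [m - lam * v], and the constant [- b] a mass for the mean
    [m]. *)
Lemma Rintegral_gauss_density_phibar (eps sigma b v m : R) : 0 < v ->
  let c := Num.sqrt (2 * v) in
  let lam := 2 * eps / sigma in
  \int[mu]_s (gauss_density v (m - s) * phibar eps sigma b s) =
  2 * (v * gauss_density v m - m * ((1 - erf (m / c)) / 2)) +
  b * (expR (lam ^+ 2 * v / 2 - lam * m) * ((1 + erf ((m - lam * v) / c)) / 2) -
       (1 + erf (m / c)) / 2).
Proof.
move=> v0 c lam.
pose f s := gauss_density v (s - m) * (- 2 * s).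
pose k := expR (lam ^+ 2 * v / 2 - lam * m).
(* The right branch with its exponential already absorbed by the tilt. *)
pose g s := b * k * gauss_density v (s - (m - lam * v)) - b * gauss_density v (s - m).
have cf : continuous f.
  move=> x; apply: cvgM; first exact: continuous_gauss_density.
  by apply: cvgM; [exact: cvg_cst|exact: cvg_id].
have f0 x : x <= 0 -> 0 <= f x.
  by move=> x0; rewrite mulr_ge0 ?gauss_density_ge0// mulNr oppr_ge0 mulr_ge0_le0.
have fN x : f (- x) = 2 * (x * gauss_density v (x - (- m))).
  by rewrite /f -opprD gauss_densityN opprK; ring.
have [IM EM] := gauss_density_moment_half_line v0 (- m).
have [I1 E1] := gauss_density_half_line v0 m.
have [I2 E2] := gauss_density_half_line v0 (m - lam * v).
have intZ (a : R) h : mu.-integrable `[0, +oo[ (EFin \o h) ->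
    mu.-integrable `[0, +oo[ (EFin \o (fun x => a * h x)).
  by move=> ih; exact: (@integrableZl _ _ _ mu _ _ a _ ih).
have [|If Ef] := Rintegral_half_line_opp cf f0.
  by rewrite (funext fN); exact: intZ.
have Ig : mu.-integrable `[0, +oo[ (EFin \o g).
  exact: (@integrableB _ _ _ mu _ _ _ _ (intZ (b * k) _ I2) (intZ b _ I1)).
rewrite (@Rintegral_split0 f g)//; last first.
  move=> x; rewrite -opprB gauss_densityN /phibar; case: ifPn => // _.
  have -> : - 2 * eps * x / sigma = - lam * x by rewrite /lam; ring.
  by rewrite mulrBr mulrCA gauss_density_tilt// /g mulrA [gauss_density v (x - m) * b]mulrC.
congr (_ + _).
  rewrite Ef; under eq_Rintegral do rewrite fN.
  have erfNc : erf (- m / c) = - erf (m / c) by rewrite mulNr erfN.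
  by rewrite RintegralZl// EM gauss_densityN erfNc; ring.
rewrite /g RintegralB//; [|exact: intZ..].
rewrite (RintegralZl _ _ I2)// (RintegralZl _ _ I1)//.
by rewrite E1 E2 -/k; ring.
Qed.

Lemma PhiE (eps T s : R) : Phi eps s (- T) = gauss_density (kappa eps * T) s.
Proof.
rewrite /Phi /gauss_density /gauss_fun.
have -> : - 2 * pi * kappa eps * - T = 2 * pi * (kappa eps * T) by ring.
(* For a nonpositive variance both prefactors are inverses of [Num.sqrt] of a nonpositive number,
   hence 0 by convention. *)
have [v0|v0] := leP (kappa eps * T) 0.
  by rewrite !ler0_sqrtr ?invr0 ?mul0r// mulr_ge0_le0// mulr_ge0// pi_ge0.
rewrite expr_div_n sqr_sqrtr; last by rewrite mulr_ge0// ltW.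
by congr (_ * expR _); rewrite !mulrN invrN mulrN !mulrA.
Qed.
End initial_datum.

(** * Scaling out [T] and passing to the limit *)

Section limit.
Context {R : realType}.
Implicit Types gamma k s B : R.

Lemma gauss_densityZ v r x : 0 < r ->
  gauss_density (v * r ^+ 2) (r * x) = r^-1 * gauss_density v x :> R.
Proof.
move=> r0; have r1 : Num.sqrt (r ^+ 2) = r by rewrite sqrtr_sqr gtr0_norm.
rewrite /gauss_density.
have -> : 2 * pi * (v * r ^+ 2) = r ^+ 2 * (2 * pi * v) by ring.
have -> : 2 * (v * r ^+ 2) = r ^+ 2 * (2 * v) by ring.
rewrite !(sqrtrM _ (sqr_ge0 r)) r1 invfM mulrA; congr (_ * gauss_fun _).
by rewrite -mulf_div divff ?mul1r// gt_eqF.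
Qed.

(** The value of [ubar] divided by [Num.sqrt T], with [k], [s], [B] standing for [kappa eps],
    [sigma] and [eps * b]; the factor [B / gamma] is [b / Num.sqrt T]. *)
Definition rescaled_ubar gamma k s B :=
  - (2 * (k * gauss_density k gamma -
          gamma * ((1 - erf (gamma / Num.sqrt (2 * k))) / 2))) -
  B / gamma *
   (expR (2 * gamma ^+ 2 / s * (k / s - 1)) *
      ((1 + erf ((gamma - 2 * k * gamma / s) / Num.sqrt (2 * k))) / 2) -
    (1 + erf (gamma / Num.sqrt (2 * k))) / 2).

Lemma ubarE gamma (eps T s b : R) : 0 < gamma -> 0 < eps < 1 -> 0 < s ->
  gamma = eps * Num.sqrt T ->
  (Num.sqrt T)^-1 * ubar eps s b (eps * T) 0 (- T) =
  rescaled_ubar gamma (kappa eps) s (eps * b).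
Proof.
move=> gamma0 /andP[eps0 eps1] s0 gammaE.
(* Positivity of [gamma] forces that of [T], so [T] is the square of [Num.sqrt T]. *)
have r0 : 0 < Num.sqrt T by rewrite -(pmulr_rgt0 _ eps0) -gammaE.
have TE : T = Num.sqrt T ^+ 2 by rewrite sqr_sqrtr// ltW// -sqrtr_gt0.
have k0 : 0 < kappa eps by rewrite subr_gt0 expr_lt1// ltW.
have v0 : 0 < kappa eps * T by rewrite mulr_gt0// -sqrtr_gt0.
rewrite /ubar mulrN subrr [phibar _ _ _ 0]/phibar lexx !mulr0 addr0 sub0r.
under eq_Rintegral do rewrite PhiE.
rewrite Rintegral_gauss_density_phibar//.
(* The mean, the width and the tilt shift are all proportional to [Num.sqrt T], which therefore
   cancels in the arguments of [erf]. *)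
have mE : eps * T = Num.sqrt T * gamma by rewrite {1}TE gammaE; ring.
have cE : Num.sqrt (2 * (kappa eps * T)) = Num.sqrt T * Num.sqrt (2 * kappa eps).
  by rewrite mulrA mulrC {1}TE sqrtrM ?sqr_ge0// sqrtr_sqr gtr0_norm.
have c0 : Num.sqrt (2 * kappa eps) != 0 by rewrite gt_eqF// sqrtr_gt0 mulr_gt0.
rewrite cE mE.
have -> : (2 * eps / s) * (kappa eps * T) = Num.sqrt T * (2 * kappa eps * gamma / s).
  by rewrite {1}TE gammaE; field; rewrite gt_eqF.
have -> : gauss_density (kappa eps * T) (Num.sqrt T * gamma) =
    (Num.sqrt T)^-1 * gauss_density (kappa eps) gamma.
  by rewrite {1}TE gauss_densityZ.
rewrite -mulrBr -!mulf_div divff ?mul1r ?gt_eqF//.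
rewrite /rescaled_ubar.
have -> : (2 * eps / s) ^+ 2 * (kappa eps * T) / 2 - 2 * eps / s * (Num.sqrt T * gamma) =
   2 * gamma ^+ 2 / s * (kappa eps / s - 1).
  by rewrite {1}TE gammaE; field; rewrite gt_eqF.
move: TE r0 gammaE gamma0; rewrite {k0 v0 mE cE c0}.
(* With the transcendental terms generalized, the rest is a rational identity. *)
move: (Num.sqrt T) (kappa eps) (erf _) (erf _) (expR _) (gauss_density _ _).
move=> r k e1 e2 ex g -> r0 -> _.
by field; rewrite !gt_eqF.
Qed.

Lemma cvg_rescaled_ubar gamma (T : Type) (F : set_system T) (FF : ProperFilter F)
    (k s B : T -> R) :
  0 < gamma ->
  k @ F --> (1 : R) -> s @ F --> (1 : R) -> B @ F --> (1 : R) ->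
  rescaled_ubar gamma (k x) (s x) (B x) @[x --> F] --> cbar gamma.
Proof.
move=> gamma0 k1 s1 B1.
(* At [k = s = 1] the exponent vanishes and the shifted mean is [- gamma], so oddness of [erf]
   merges the two masses. *)
have E : cbar gamma = rescaled_ubar gamma 1 1 1.
  rewrite /cbar /rescaled_ubar /gauss_density /gauss_fun.
  rewrite !mulr1 !divr1 subrr mulr0 expR0 !mul1r.
  have -> : gamma - 2 * gamma = - gamma by ring.
  have -> : erf (- gamma / Num.sqrt 2) = - erf (gamma / Num.sqrt 2) by rewrite mulNr erfN.
  have -> : - gamma ^+ 2 / 2 = - (gamma / Num.sqrt 2) ^+ 2.
    by rewrite expr_div_n sqr_sqrtr// mulNr.
  have -> : Num.sqrt (2 / pi) = 2 / Num.sqrt (2 * pi) :> R.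
    rewrite !sqrtrM// sqrtrV ?pi_ge0//.
    have h : Num.sqrt 2 ^+ 2 = 2 :> R by rewrite sqr_sqrtr.
    rewrite -[X in X / (_ * _)]h; field.
    by rewrite !gt_eqF ?sqrtr_gt0 ?pi_gt0.
  field.
  by rewrite !gt_eqF ?sqrtr_gt0 ?mulr_gt0 ?pi_gt0.
rewrite E.
have sV : (s x)^-1 @[x --> F] --> (1 : R)^-1 by apply: cvgV; rewrite ?oner_eq0.
(* Used with [a = 2 * pi] for the density prefactor and with [a = 2] for the standardized
   arguments. *)
have sq (a : R) : 0 < a -> (Num.sqrt (a * k x))^-1 @[x --> F] --> (Num.sqrt (a * 1))^-1.
  move=> a0; apply: cvgV; first by rewrite mulr1 gt_eqF// sqrtr_gt0.
  apply: continuous_cvg; first exact: sqrt_continuous.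
  by apply: cvgM => //; exact: cvg_cst.
have ks : k x / s x @[x --> F] --> (1 : R) / 1 by exact: cvgM.
have e1 : erf (gamma / Num.sqrt (2 * k x)) @[x --> F] --> erf (gamma / Num.sqrt (2 * 1)).
  apply: continuous_cvg; first exact: continuous_erf.
  by apply: cvgM; [exact: cvg_cst|exact: sq].
apply: cvgB.
  apply: cvgN; apply: cvgM; first exact: cvg_cst.
  apply: cvgB; (apply: cvgM; first by [exact: k1|exact: cvg_cst]).
    apply: cvgM; first by apply: sq; rewrite mulr_gt0 ?pi_gt0.
    apply: continuous_cvg; first exact: continuous_gauss_fun.
    by apply: cvgM; [exact: cvg_cst|exact: sq].
  apply: cvgM; last exact: cvg_cst.
  by apply: cvgB => //; exact: cvg_cst.
apply: cvgM; first by apply: cvgM => //; exact: cvg_cst.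
apply: cvgB; last first.
  apply: cvgM; last exact: cvg_cst.
  by apply: cvgD => //; exact: cvg_cst.
apply: cvgM.
  apply: continuous_cvg; first exact: continuous_expR.
  apply: cvgM; first by apply: cvgM => //; exact: cvg_cst.
  by apply: cvgB => //; exact: cvg_cst.
apply: cvgM; last exact: cvg_cst.
apply: cvgD; first exact: cvg_cst.
apply: continuous_cvg; first exact: continuous_erf.
apply: cvgM; last exact: sq.
apply: cvgB; first exact: cvg_cst.
apply: cvgM => //; apply: cvgM; last exact: cvg_cst.
by apply: cvgM => //; exact: cvg_cst.
Qed.

Lemma cvg_kappa : kappa x @[x --> (0 : R)^'+] --> (1 : R).
Proof.
have h : 1 = 1 - 0 ^+ 2 :> R by rewrite expr0n subr0.
rewrite [X in _ --> X]h; apply: cvgB; first exact: cvg_cst.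
apply: cvg_at_right_filter; exact: exprn_continuous.
Qed.

(** For [0 < x < 1] the logarithm splits, and the expression is twice the inverse of the difference
    quotient at 0 of [ln (1 + x) - ln (1 - x)], whose derivative there is 2. *)
Lemma cvg_eps_div_ln :
  2 * x / ln ((1 + x) / (1 - x)) @[x --> (0 : R)^'+] --> (1 : R).
Proof.
have d : is_derive (0 : R) 1 (fun x : R => ln (1 + x) - ln (1 - x)) 2.
  have dp : is_derive (0 : R) 1 (fun x : R => 1 + x) 1.
    by apply: is_derive_eq; rewrite /GRing.scale/=; ring.
  have dm : is_derive (0 : R) 1 (fun x : R => 1 - x) (-1).
    by apply: is_derive_eq; rewrite /GRing.scale/=; ring.
  have lp : is_derive (1 + 0 : R) 1 (@ln R) 1.
    by rewrite addr0 -[X in is_derive _ _ _ X]invr1; exact: is_derive1_ln.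
  have lm : is_derive (1 - 0 : R) 1 (@ln R) 1.
    by rewrite subr0 -[X in is_derive _ _ _ X]invr1; exact: is_derive1_ln.
  have d1 := @is_derive1_comp R (@ln R) (fun x => 1 + x) 0 1 1 lp dp.
  have d2 := @is_derive1_comp R (@ln R) (fun x => 1 - x) 0 1 (-1) lm dm.
  by apply: is_derive_eq; ring.
have q : h^-1 * (ln (1 + h) - ln (1 - h)) @[h --> (0 : R)^'+] --> (2 : R).
  apply: cvg_dnbhs_at_right; case: d => d <-.
  move: d; rewrite /derivable /derive /=.
  by under eq_fun do
    rewrite addr0 subr0 !addr0 ln1 subrr subr0 /GRing.scale/= mulr1.
have : 2 * (h^-1 * (ln (1 + h) - ln (1 - h)))^-1 @[h --> (0 : R)^'+] --> (2 * 2^-1 : R).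
  by apply: cvgM; [exact: cvg_cst|apply: cvgV].
rewrite divff//; apply: cvg_trans; apply: near_eq_cvg.
near=> x.
have x0 : 0 < x by [].
have x1 : x < 1 by near: x; exact: nbhs_right_lt.
by rewrite ln_div ?posrE ?subr_gt0 ?addr_gt0// invfM invrK mulrA.
Unshelve. all: by end_near. Qed.

End limit.

Theorem mainTheorem8 (R : realType) (gamma : R) (hgamma : 0 < gamma)
    (T sigma b : R -> R)
    (hT : forall eps : R, 0 < eps < 1 -> gamma = eps * Num.sqrt (T eps))
    (hsigma :
      (forall eps : R, 0 < eps < 1 -> sigma eps = kappa eps) \/
      (forall eps : R, 0 < eps < 1 ->
         sigma eps = 2 * eps / ln ((1 + eps) / (1 - eps))))
    (hb_pos : forall eps : R, 0 < eps < 1 -> 0 < b eps)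
    (hb : eps * b eps @[eps --> (0 : R)^'+] --> (1 : R)) :
  (Num.sqrt (T eps))^-1 *
    ubar eps (sigma eps) (b eps) (eps * T eps) 0 (- T eps)
    @[eps --> (0 : R)^'+] --> cbar gamma.
Proof.
have in01 : \forall x \near (0 : R)^'+, 0 < x < 1.
  by near=> x; apply/andP; split; [|near: x; exact: nbhs_right_lt].
(* Both choices of [sigma] tend to 1; from here on they are treated alike, and positivity near 0
   follows from the limit. *)
have sigma1 : sigma x @[x --> (0 : R)^'+] --> (1 : R).
  case: hsigma => sigmaE.
    apply: cvg_trans cvg_kappa; apply: near_eq_cvg.
    by near=> x; rewrite sigmaE//; near: x.
  apply: cvg_trans cvg_eps_div_ln; apply: near_eq_cvg.
  by near=> x; rewrite sigmaE//; near: x.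
have sigma0 : \forall x \near (0 : R)^'+, 0 < sigma x.
  exact: (cvgr_gt _ sigma1).
have h : rescaled_ubar gamma (kappa x) (sigma x) (x * b x)
    @[x --> (0 : R)^'+] --> cbar gamma.
  by apply: cvg_rescaled_ubar => //; exact: cvg_kappa.
apply: cvg_trans h; apply: near_eq_cvg; near=> x.
have x01 : 0 < x < 1 by near: x.
by rewrite (ubarE _ hgamma)//; [near: x|exact: hT].
Unshelve. all: by end_near. Qed.
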